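(* Let $\mathcal{X}$ be a finite connected polygonal complex, $*$ a vertex of $\mathcal{X}$, and $T$ a spanning tree of the underlying graph $G(\mathcal{X})$. Let $\pi_1(\mathcal{X},* )\cong\langle S\mid R\rangle$ be the presentation of the fundamental group of $\mathcal{X}$ associated with retracting $T$ to the basepoint $*$. Let $\rho\colon\mathbb{R}_{\ge 0}\to\mathbb{R}_{\ge 0}$ be a rate function. Then: (1) If $\langle S|R\rangle$ is $\rho$-homomorphism stable, then $\mathcal{X}$ is $\rho$-cocycle stable. (2) If $\mathcal{X}$ is $\rho$-cocycle stable, then $\langle S|R\rangle$ is $\left(|\overrightarrow{E}(\mathcal{X})|\cdot\rho\right)$-homomorphism stable, where $|\overrightarrow{E}(\mathcal{X})|$ is the number of directed edges of $\mathcal{X}$.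
   Context: **Rate function.** A non-decreasing $\rho\colon\mathbb{R}_{\ge0}\to\mathbb{R}_{\ge0}$ with $\rho(\varepsilon)\to0$ as $\varepsilon\to0$. **Graphs and polygonal complexes.** A graph consists of a set $V$ of vertices, a set $\overrightarrow{E}$ of directed edges, maps $\iota,\tau\colon\overrightarrow{E}\to V$ (origin, terminus) and a fixed-point-free involution $e\mapsto\bar e$ of $\overrightarrow{E}$ with $\tau(\bar e)=\iota(e)$; loops and multiple edges are allowed. $E=\{[e]=\{e,\bar e\}\}$ is the set of unoriented edges. A path $e_1\cdots e_\ell$ satisfies $\tau(e_i)=\iota(e_{i+1})$ and is closed if $\iota(e_1)=\tau(e_\ell)$. The orientations of a closed path $\pi$ are its cyclic shifts and their reverses (the reverse of $e_1\cdots e_\ell$ being $\bar e_\ell\cdots\bar e_1$); $[\pi]$ denotes the set of them. A closed path is cyclically reduced if no orientation of it contains consecutive edges $e\bar e$. A polygonal complex $\mathcal{X}$ is a graph $G(\mathcal{X})$ with a set $\overrightarrow{P}(\mathcal{X})$ of cyclically reduced closed paths of positive length (oriented polygons) closed under passing to orientations; $P(\mathcal{X})=\{[\pi]\}$ is the set of unoriented polygons. $\mathcal{X}$ is finite if $V,E,P$ are finite, and connected if $G(\mathcal X)$ is connected. **Presentation associated with $T$.** $S$ consists of a chosen representative $e$ of every unoriented edge $\{e,\bar e\}\in E(\mathcal{X})$ outside $T$. $R$ consists of one relation for each unoriented polygon $[\pi]\in P(\mathcal{X})$: take a chosen representative $\pi$ and read it as a word in $S$ by replacing each $\bar e$ with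 $e\in S$ by $e^{-1}$ and deleting every edge lying in $T$. This is a presentation of $\pi_1(\mathcal{X},* )$. **Distance of permutations.** $\mathrm{Sym}(n)$ acts on $[n]=\{1,\dots,n\}$. For $\sigma\in\mathrm{Sym}(n),\tau\in\mathrm{Sym}(N)$, $$d_h(\sigma,\tau)=1-\frac{|\{i\le\min(n,N):\sigma(i)=\tau(i)\}|}{\max(n,N)}.$$ Expectations are with respect to uniform distributions; an average over an empty set is taken to be $0$. **Homomorphism stability.** A map $f\colon S\to\mathrm{Sym}(n)$ extends uniquely to a homomorphism from the free group on $S$, also denoted $f$. For $f\colon S\to\mathrm{Sym}(n)$ and $g\colon S\to\mathrm{Sym}(N)$ put $d_h(f,g)=\mathbb{E}_{s\in S}[d_h(f(s),g(s))]$. Let $\mathrm{def}_{hom}(f)=\mathbb{E}_{r\in R}[d_h(f(r),\mathrm{Id})]$ and $\mathrm{Def}_{hom}(f)=\inf\{d_h(f,\varphi)\mid N\in\mathbb{N},\ \varphi\colon S\to\mathrm{Sym}(N),\ \varphi(r)=\mathrm{Id}\ \forall r\in R\}$. $\langle S|R\rangle$ is $\rho$-homomorphism stable if $\mathrm{Def}_{hom}(f)\le\rho(\mathrm{def}_{hom}(f))$ for all $n$ and all $f\colon S\to\mathrm{Sym}(n)$. **Cocycle stability.** A $1$-cochain of $\mathcal{X}$ is a map $\alpha\colon\overrightarrow{E}(\mathcal{X})\to\mathrm{Sym}(n)$ (some $n\geq 2$) with $\alpha(\bar e)=\alpha(e)^{-1}$. For a polygon $\pi=e_1\cdots e_\ell$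 put $\delta\alpha(\pi)=\alpha(e_1)\cdots\alpha(e_\ell)$; $\alpha$ is a $1$-cocycle if $\delta\alpha(\pi)=\mathrm{Id}$ for all polygons $\pi$. Put $d_h(\alpha,\beta)=\mathbb{E}_{[e]\in E(\mathcal{X})}[d_h(\alpha(e),\beta(e))]$, $\mathrm{def}_{cocyc}(\alpha)=\mathbb{E}_{[\pi]\in P(\mathcal{X})}[d_h(\delta\alpha(\pi),\mathrm{Id})]$ (independent of representatives), and $\mathrm{Def}_{cocyc}(\alpha)=\inf\{d_h(\alpha,\varphi)\mid\varphi\text{ a }1\text{-cocycle with values in some }\mathrm{Sym}(N)\}$. $\mathcal{X}$ is $\rho$-cocycle stable if $\mathrm{Def}_{cocyc}(\alpha)\le\rho(\mathrm{def}_{cocyc}(\alpha))$ for every $1$-cochain $\alpha$ (for every $n$). *)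

(* Defs.v *)
From HB Require Import structures.
From mathcomp Require Import all_boot all_order all_algebra.
From mathcomp Require Import fingroup perm.
From mathcomp Require Import finmap.
From mathcomp Require Import boolp classical_sets reals topology normedtype.

Set Implicit Arguments.
Unset Strict Implicit.
Unset Printing Implicit Defensive.

Import Order.TTheory GRing.Theory Num.Theory.
Import numFieldNormedType.Exports.

Local Open Scope fset_scope.
Local Open Scope ring_scope.

(* A rate function lives on the nonnegative reals: only the restriction of
   [rho] to [0, +oo[ is constrained, and only that restriction is used. *)
Definition rate_function (R : realType) (rho : R -> R) : Prop :=
  [/\ forall x, 0 <= x -> 0 <= rho x,
      forall x y, 0 <= x -> x <= y -> rho x <= rho y
    & (rho x @[x --> 0^'+] --> (0 : R))%classic].

(* The average over an empty type is 0, because 0^-1 = 0. *)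
Definition average (R : realType) (I : finType) (F : I -> R) : R :=
  (\sum_(i : I) F i) / #|I|%:R.

Definition d_h (R : realType) (n N : nat) (s : 'S_n) (t : 'S_N) : R :=
  1 - #|[set i : 'I_(minn n N) |
           (s (widen_ord (geq_minl n N) i) : nat)
           == t (widen_ord (geq_minr n N) i)]|%:R
      / (maxn n N)%:R.

Record graph := Graph {
  vert : finType;
  dedge : finType;
  orig : dedge -> vert;
  term : dedge -> vert;
  bar : dedge -> dedge;
  barK : involutive bar;
  bar_neq : forall e, bar e != e;
  term_bar : forall e, term (bar e) = orig e
}.

(* Paths are sequences of directed edges.  [path.cycle] relates consecutive
   edges, and the last edge to the first one. *)
Definition closed_path (G : graph) (p : seq (dedge G)) : bool :=
  path.cycle (fun e f => term e == orig f) p.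

Definition reverse_path (G : graph) (p : seq (dedge G)) : seq (dedge G) :=
  rev (map (@bar G) p).

Definition cyclic_shifts (G : graph) (p : seq (dedge G)) :
    seq (seq (dedge G)) :=
  [seq rot k p | k <- iota 0 (size p)].

Definition orientations (G : graph) (p : seq (dedge G)) :
    {fset (seq (dedge G))} :=
  [fset q in cyclic_shifts p ++ map (@reverse_path G) (cyclic_shifts p)].

Definition cyclically_reduced (G : graph) (p : seq (dedge G)) : Prop :=
  forall q, q \in orientations p ->
  forall e : dedge G, ~~ infix [:: e; bar e] q.

Definition uedges (G : graph) : {set {set (dedge G)}} :=
  [set [set e; bar e] | e : dedge G]%SET.

Definition uedge (G : graph) : finType := {c : {set (dedge G)} | c \in uedges G}.

Definition joined_by (G : graph) (A : {set (dedge G)}) : rel (vert G) :=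
  fun u v => [exists e in A, (orig e == u) && (term e == v)].

Definition connected_graph (G : graph) : Prop :=
  forall u v : vert G, connect (joined_by [set: dedge G]%SET) u v.

(* [T] is the set of directed edges of the tree. *)
Definition spanning_tree (G : graph) (T : {set (dedge G)}) : Prop :=
  [/\ forall e, e \in T -> bar e \in T,
      forall u v : vert G, connect (joined_by T) u v
    & forall p : seq (dedge G), (0 < size p)%N -> closed_path p ->
        cyclically_reduced p -> ~~ all (mem T) p].

(* [opoly] is the set of oriented polygons. *)
Record polygonal_complex := PolygonalComplex {
  skeleton :> graph;
  opoly : {fset (seq (dedge skeleton))};
  opolyP : forall p, p \in opoly ->
    [/\ (0 < size p)%N, closed_path p & cyclically_reduced p];
  opoly_orientations : forall p, p \in opoly -> orientations p `<=` opoly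
}.

Definition upolygons (X : polygonal_complex) :
    {fset {fset (seq (dedge X))}} :=
  [fset orientations p | p in opoly X].

Definition upolygon (X : polygonal_complex) : finType := upolygons X.

(* The head is a representative because polygons are nonempty sets; cyclic
   shifts conjugate [coboundary alpha] and reversal inverts it, so the choice
   does not affect [def_cocyc]. *)
Definition polygon_repr (X : polygonal_complex) (c : upolygon X) :
    seq (dedge X) :=
  head [::] (enum_fset (val c)).

(* Products in ['S_n] are those of MathComp: [s * t] is
   [s] followed by [t].  Since [d_h] is invariant under inverting both
   arguments, pre-composing maps with inversion identifies the stability
   notions below with those for the opposite convention. *)

Definition cochain (X : polygonal_complex) (n : nat)
    (alpha : dedge X -> 'S_n) : Prop :=
  (2 <= n)%N /\ forall e, alpha (bar e) = ((alpha e)^-1)%g.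

Definition coboundary (X : polygonal_complex) (n : nat)
    (alpha : dedge X -> 'S_n) (p : seq (dedge X)) : 'S_n :=
  (\prod_(e <- p) alpha e)%g.

Definition cocycle (X : polygonal_complex) (n : nat)
    (alpha : dedge X -> 'S_n) : Prop :=
  cochain alpha /\ forall p, p \in opoly X -> coboundary alpha p = 1%g.

(* For cochains, [d_h R (alpha e) (beta e)] is unchanged when [e] is replaced
   by [bar e], so the representative found by [pick] is immaterial. *)
Definition d_cochain (R : realType) (X : polygonal_complex) (n N : nat)
    (alpha : dedge X -> 'S_n) (beta : dedge X -> 'S_N) : R :=
  average (fun c : uedge X =>
    if [pick e in val c] is Some e then d_h R (alpha e) (beta e) else 0).

Definition def_cocyc (R : realType) (X : polygonal_complex) (n : nat)
    (alpha : dedge X -> 'S_n) : R :=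
  average (fun c : upolygon X =>
    d_h R (coboundary alpha (polygon_repr c)) (1%g : 'S_n)).

Definition Def_cocyc (R : realType) (X : polygonal_complex) (n : nat)
    (alpha : dedge X -> 'S_n) : R :=
  inf [set x : R | exists (N : nat) (phi : dedge X -> 'S_N),
                     cocycle phi /\ x = d_cochain R alpha phi]%classic.

Definition cocycle_stable (R : realType) (rho : R -> R)
    (X : polygonal_complex) : Prop :=
  forall (n : nat) (alpha : dedge X -> 'S_n), cochain alpha ->
    Def_cocyc R alpha <= rho (def_cocyc R alpha).

(* Relations are indexed by a finite type, so that a
   word may occur several times as a relation.  The letter [(s, true)] stands
   for the inverse of the generator [s]. *)

Record presentation := Presentation {
  gens : finType;
  rels : finType;
  relator : rels -> seq (gens * bool)
}.

Definition eval_word (S : finType) (n : nat) (f : S -> 'S_n)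
    (w : seq (S * bool)) : 'S_n :=
  (\prod_(l <- w) (if l.2 then (f l.1)^-1 else f l.1))%g.

Definition d_gens (R : realType) (S : finType) (n N : nat)
    (f : S -> 'S_n) (g : S -> 'S_N) : R :=
  average (fun s : S => d_h R (f s) (g s)).

Definition def_hom (R : realType) (P : presentation) (n : nat)
    (f : gens P -> 'S_n) : R :=
  average (fun r : rels P => d_h R (eval_word f (relator r)) (1%g : 'S_n)).

Definition Def_hom (R : realType) (P : presentation) (n : nat)
    (f : gens P -> 'S_n) : R :=
  inf [set x : R | exists (N : nat) (phi : gens P -> 'S_N),
         [/\ (0 < N)%N,
             forall r : rels P, eval_word phi (relator r) = 1%g
           & x = d_gens R f phi]]%classic.

Definition hom_stable (R : realType) (rho : R -> R) (P : presentation) :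
    Prop :=
  forall (n : nat) (f : gens P -> 'S_n), (0 < n)%N ->
    Def_hom R f <= rho (def_hom R f).

(* The presentation associated with a spanning tree [T], given one chosen
   representative of each unoriented edge outside [T] (the set [S]) and of each
   unoriented polygon (the map [rep]). *)

Definition edge_representatives (G : graph) (T S : {set (dedge G)}) : Prop :=
  (forall e, e \in S -> e \notin T) /\
  (forall e, e \notin T -> (e \in S) (+) (bar e \in S)).

Definition letter (G : graph) (S : {set (dedge G)}) (e : dedge G) :
    option ({s : dedge G | s \in S} * bool) :=
  if insub e is Some s then Some (s, false)
  else if insub (bar e) is Some s then Some (s, true) else None.

Definition word_of_path (G : graph) (T S : {set (dedge G)})
    (p : seq (dedge G)) : seq ({s : dedge G | s \in S} * bool) :=
  pmap (letter S) [seq e <- p | e \notin T].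

Definition tree_presentation (X : polygonal_complex)
    (T S : {set (dedge X)}) (rep : upolygon X -> seq (dedge X)) :
    presentation :=
  @Presentation {s : dedge X | s \in S} (upolygon X)
    (fun c => word_of_path T S (rep c)).

(* Main.v *)
Require Import Defs.
From mathcomp Require Import classical_sets reals.
From mathcomp Require Import finmap.
From mathcomp Require Import all_boot all_order all_algebra.
From mathcomp Require Import fingroup perm.

(** Both implications rest on a gauge transformation.  For a vertex [v] let
    [c v] be the product of a cochain [alpha] along the tree walk from the base
    vertex to [v].  Replacing [alpha e] by [c (orig e) * alpha e * (c (term e))^-1]
    gives a cochain that is trivial on the tree, because a closed path inside a
    tree reduces to the empty path by cancelling backtracks
    ([coboundary_closed_tree_path]).  A cochain that is trivial on the tree is the
    same thing as a map of the generators, and its coboundary along a polygon is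
    the value of the corresponding relator ([eval_word_extend]).  The gauge only
    conjugates coboundaries of closed paths, so it preserves cocycles, and it
    preserves the defect because the distance is bi-invariant
    ([d_h_translate]).  Hence [def_hom] and [def_cocyc] correspond exactly, and
    what remains is to compare the two infima.

    For (1), let [f] be the gauged [alpha], restricted to the generators.  From a
    homomorphism near [f] one undoes the gauge and gets a cocycle near [alpha].
    The permutations may act on different numbers [n] and [N] of points: if
    [N < n] the homomorphism is first widened by fixed points, which brings it
    closer, and if [n < N] the gauge is widened.  Then two identity
    permutations on tree edges are at distance [1 - n / N], but this is the least
    possible distance, so the average over all edges is at most the average over
    the generators ([average_extend_min], [exists_cocycle_near]).

    For (2), let [alpha] be the extension of [f] by the identity on the tree.
    Gauging a cocycle near [alpha] multiplies its values along loops that use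
    each unoriented edge at most twice, so subadditivity of the distance along
    paths ([d_h_coboundary]) loses at most twice the number of unoriented edges,
    which is the number of directed edges ([exists_hom_near]). *)

Set Implicit Arguments.
Unset Strict Implicit.
Unset Printing Implicit Defensive.

Import Order.TTheory GRing.Theory Num.Theory.

Local Open Scope ring_scope.

(** * Permutations on different numbers of points *)

(** Letting a permutation of n points act on all natural numbers makes
    permutations of different sizes comparable without casts between ordinals. *)
Definition nat_action (n : nat) (s : 'S_n) (i : nat) : nat :=
  if insub i is Some j then s j else i.

Lemma nat_action_ord n (s : 'S_n) (i : 'I_n) : nat_action s i = s i.
Proof. by rewrite /nat_action valK. Qed.

Lemma nat_action_lt n (s : 'S_n) i : (nat_action s i < n)%N = (i < n)%N.
Proof.
by rewrite /nat_action; case: insubP => [j -> _|/negbTE ->]; rewrite ?ltn_ord.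
Qed.

Lemma nat_action1 n i : nat_action (1%g : 'S_n) i = i.
Proof. by rewrite /nat_action; case: insubP => // j _ <-; rewrite perm1. Qed.

Lemma nat_actionM n (s t : 'S_n) i :
  nat_action (s * t)%g i = nat_action t (nat_action s i).
Proof.
rewrite {1 3}/nat_action; case: insubP => [j _ _|/negbTE ni].
  by rewrite permM nat_action_ord.
by rewrite /nat_action insubF.
Qed.

Lemma nat_actionK n (s : 'S_n) : cancel (nat_action s) (nat_action s^-1%g).
Proof. by move=> i; rewrite -nat_actionM mulgV nat_action1. Qed.

Lemma nat_actionVK n (s : 'S_n) : cancel (nat_action s^-1%g) (nat_action s).
Proof. by move=> i; rewrite -nat_actionM mulVg nat_action1. Qed.

Lemma nat_action_inj n (s t : 'S_n) : nat_action s =1 nat_action t -> s = t.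
Proof.
by move=> st; apply/permP=> i; apply: val_inj; rewrite /= -!nat_action_ord st.
Qed.

Definition widen_perm_fun n N (s : 'S_n) (i : 'I_N) : 'I_N :=
  insubd i (nat_action s i).

Lemma widen_perm_funE n N (le_nN : (n <= N)%N) (s : 'S_n) (i : 'I_N) :
  widen_perm_fun s i = nat_action s i :> nat.
Proof.
rewrite val_insubd; case: ltnP => // le_N.
have ge_n : (n <= i)%N.
  by rewrite leqNgt -(nat_action_lt s) -leqNgt (leq_trans le_nN).
by rewrite /nat_action insubF // ltnNge ge_n.
Qed.

Lemma widen_perm_subproof n N (le_nN : (n <= N)%N) (s : 'S_n) :
  injective (@widen_perm_fun n N s).
Proof.
move=> i j /(congr1 val); rewrite /= !widen_perm_funE //.
by move/(can_inj (nat_actionK s))/val_inj.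
Qed.

Definition widen_perm n N (le_nN : (n <= N)%N) (s : 'S_n) : 'S_N :=
  perm (widen_perm_subproof le_nN (s := s)).

Lemma nat_action_widen n N (le_nN : (n <= N)%N) (s : 'S_n) :
  nat_action (widen_perm le_nN s) =1 nat_action s.
Proof.
move=> i; rewrite {1}/nat_action; case: insubP => [j _ <-|].
  by rewrite permE widen_perm_funE.
by rewrite -leqNgt => le_N; rewrite /nat_action insubF // ltnNge (leq_trans le_nN).
Qed.

Lemma widen_permM n N (le_nN : (n <= N)%N) :
  {morph widen_perm le_nN : s t / (s * t)%g}.
Proof.
move=> s t; apply: nat_action_inj => i.
by rewrite nat_actionM !nat_action_widen nat_actionM.
Qed.

Lemma widen_perm1 n N (le_nN : (n <= N)%N) : widen_perm le_nN 1%g = 1%g.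
Proof. by apply: nat_action_inj => i; rewrite nat_action_widen !nat_action1. Qed.

Lemma widen_permV n N (le_nN : (n <= N)%N) :
  {morph widen_perm le_nN : s / s^-1%g}.
Proof.
by move=> s; apply/eqP; rewrite eq_sym eq_invg_mul -widen_permM mulgV widen_perm1.
Qed.

Lemma widen_perm_id n (le_nn : (n <= n)%N) (s : 'S_n) : widen_perm le_nn s = s.
Proof. by apply: nat_action_inj; apply: nat_action_widen. Qed.

(** * The distance of permutations *)

Lemma widen_ord_inj n N (le_nN : (n <= N)%N) : injective (widen_ord le_nN).
Proof. by move=> i j /(congr1 val) eij; apply: val_inj. Qed.

Definition agreement (n N M : nat) (s : 'S_n) (t : 'S_N) : {set 'I_M} :=
  [set i : 'I_M | (i < minn n N)%N && (nat_action s i == nat_action t i)].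

Section Distance.
Variable R : realType.

Lemma d_hE n N M (s : 'S_n) (t : 'S_N) : maxn n N = M ->
  d_h R s t = 1 - #|agreement M s t|%:R / M%:R.
Proof.
move=> <-; rewrite /d_h; congr (1 - _%:R / _).
have le_m : (minn n N <= maxn n N)%N.
  by rewrite (leq_trans (geq_minl _ _)) ?leq_maxl.
rewrite -(card_imset _ (@widen_ord_inj _ _ le_m)); apply: eq_card => i.
rewrite inE; apply/imsetP/andP => [[j]|[lt_i e]].
  rewrite inE => e -> /=; split; first exact: ltn_ord.
  by move: e; rewrite -!nat_action_ord.
exists (Ordinal lt_i); last exact: val_inj.
by rewrite inE -!nat_action_ord.
Qed.

(** With the smaller permutation on the left, the distance is the proportion of
    points outside the agreement set; the points beyond the domain of the
    smaller permutation count as disagreements. *)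
Lemma d_h_disagreement n N (s : 'S_n) (t : 'S_N) : (n <= N)%N -> (0 < N)%N ->
  d_h R s t = #|~: agreement N s t|%:R / N%:R.
Proof.
move=> le_nN N0; rewrite (@d_hE _ _ N); last exact/maxn_idPr.
rewrite [in RHS]cardsCs setCK card_ord.
rewrite natrB ?mulrBl ?divff ?pnatr_eq0 -?lt0n //.
by rewrite -[X in (_ <= X)%N]card_ord max_card.
Qed.

Lemma d_h_ge0 n N (s : 'S_n) (t : 'S_N) : 0 <= d_h R s t.
Proof.
rewrite (@d_hE _ _ _ s t erefl) subr_ge0; case: (posnP (maxn n N)) => [->|M0].
  by rewrite invr0 mulr0.
rewrite ler_pdivrMr ?ltr0n // mul1r ler_nat.
by rewrite -[X in (_ <= X)%N]card_ord max_card.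
Qed.

(** Widening the second permutation by fixed points leaves the denominator
    unchanged and can only create agreements, so one may always suppose that the
    second permutation acts on at least as many points as the first. *)
Lemma d_h_widen_le n N M (le_NM : (N <= M)%N) (s : 'S_n) (t : 'S_N) :
  maxn n N = M -> d_h R s (widen_perm le_NM t) <= d_h R s t.
Proof.
move=> eM; have le_nM : (n <= M)%N by rewrite -eM leq_maxl.
rewrite (@d_hE _ _ M s t) // (@d_hE _ _ M); last exact/maxn_idPr.
rewrite lerB // ler_wpM2r ?invr_ge0 ?ler0n // ler_nat.
apply/subset_leq_card/subsetP=> i; rewrite !inE nat_action_widen => /andP[lt_i ->].
by rewrite andbT (leq_trans lt_i) // leq_min geq_minl (leq_trans (geq_minr _ _)).
Qed.

Section NestedDomains.
Variables (n N : nat) (le_nN : (n <= N)%N) (N_gt0 : (0 < N)%N).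

Lemma in_agreement (s : 'S_n) (t : 'S_N) (i : 'I_N) :
  (i \in agreement N s t) = (i < n)%N && (nat_action s i == t i).
Proof. by rewrite inE (minn_idPl le_nN) nat_action_ord. Qed.

Lemma d_h_ge (s : 'S_n) (t : 'S_N) : 1 - n%:R / N%:R <= d_h R s t.
Proof.
rewrite (@d_hE _ _ N); last exact/maxn_idPr.
rewrite lerB // ler_wpM2r ?invr_ge0 ?ler0n // ler_nat.
rewrite -[X in (_ <= X)%N]card_ord -(card_imset predT (@widen_ord_inj _ _ le_nN)).
apply/subset_leq_card/subsetP=> i; rewrite in_agreement => /andP[lt_i _].
by apply/imsetP; exists (Ordinal lt_i) => //; apply: val_inj.
Qed.

Lemma d_h11 : d_h R (1%g : 'S_n) (1%g : 'S_N) = 1 - n%:R / N%:R.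
Proof.
rewrite (@d_hE _ _ N); last exact/maxn_idPr.
congr (1 - _%:R / _).
rewrite -[RHS]card_ord -(card_imset predT (@widen_ord_inj _ _ le_nN)).
apply: eq_card=> i; rewrite in_agreement nat_action1 perm1 eqxx andbT.
apply/idP/imsetP=> [lt_i|[j _ ->]]; last exact: (ltn_ord j).
by exists (Ordinal lt_i) => //; apply: val_inj.
Qed.

(** Left translation by [a] carries the agreement set back along the widening of
    [a], which permutes the first [n] points among themselves. *)
Lemma d_h_translate (a s b : 'S_n) (t : 'S_N) :
  d_h R (a * s * b)%g (widen_perm le_nN a * t * widen_perm le_nN b)%g
    = d_h R s t.
Proof.
rewrite !d_h_disagreement //; congr (_%:R / _).
rewrite -[RHS](card_preimset _ (@perm_inj _ (widen_perm le_nN a))).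
apply: eq_card => i; rewrite !inE !(minn_idPl le_nN); congr (~~ _).
have eai : widen_perm le_nN a i = nat_action a i :> nat.
  by rewrite -nat_action_ord nat_action_widen.
rewrite !nat_actionM !nat_action_widen eai nat_action_lt.
by rewrite (can_eq (nat_actionK b)).
Qed.

Lemma d_hV (s : 'S_n) (t : 'S_N) : d_h R s^-1%g t^-1%g = d_h R s t.
Proof.
rewrite !d_h_disagreement //; congr (_%:R / _).
rewrite -[RHS](card_preimset _ (@perm_inj _ (widen_perm le_nN s^-1%g))).
apply: eq_card => i; rewrite !inE !(minn_idPl le_nN); congr (~~ _).
have esi : widen_perm le_nN s^-1%g i = nat_action s^-1%g i :> nat.
  by rewrite -nat_action_ord nat_action_widen.
rewrite esi nat_action_lt nat_actionVK; congr (_ && _).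
by rewrite -(can_eq (nat_actionK t)) nat_actionVK eq_sym.
Qed.

(** A point where the products differ is a point where the first factors differ
    or is sent by the first factor to a point where the second factors differ. *)
Lemma d_hM (s1 s2 : 'S_n) (t1 t2 : 'S_N) :
  d_h R (s1 * s2)%g (t1 * t2)%g <= d_h R s1 t1 + d_h R s2 t2.
Proof.
rewrite !d_h_disagreement // -mulrDl ler_wpM2r ?invr_ge0 ?ler0n //.
rewrite -natrD ler_nat.
rewrite -(card_preimset (~: agreement N s2 t2) (@perm_inj _ (widen_perm le_nN s1))).
apply: leq_trans (leq_card_setU _ _).
apply/subset_leq_card/subsetP=> i; rewrite !inE !(minn_idPl le_nN) -negb_and.
apply: contra => /andP[/andP[lt_i /eqP e1]].
have esi : widen_perm le_nN s1 i = nat_action s1 i :> nat.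
  by rewrite -nat_action_ord nat_action_widen.
by rewrite lt_i esi !nat_actionM -e1 => /andP[_ ->].
Qed.

End NestedDomains.
End Distance.

(** * Walks *)

Section Walks.
Variable G : graph.
Implicit Types (u v w : vert G) (e : dedge G) (p q : seq (dedge G)).

Fixpoint walk u p v : bool :=
  if p is e :: p' then (orig e == u) && walk (term e) p' v else u == v.

Lemma walk_cat u p w q v : walk u p w -> walk w q v -> walk u (p ++ q) v.
Proof.
elim: p u => [|e p IHp] u /=; first by move/eqP->.
by case/andP=> -> /IHp; apply.
Qed.

Lemma walk_catP u p q v :
  walk u (p ++ q) v -> exists2 w, walk u p w & walk w q v.
Proof.
elim: p u => [|e p IHp] u /=; first by exists u.
by case/andP=> -> /IHp[w pw wq]; exists w.
Qed.

Lemma orig_bar e : orig (bar e) = term e.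
Proof. by rewrite -term_bar barK. Qed.

Lemma reverse_path_cons e p :
  reverse_path (e :: p) = reverse_path p ++ [:: bar e].
Proof. by rewrite /reverse_path /= rev_cons cats1. Qed.

Lemma walk_reverse u p v : walk u p v -> walk v (reverse_path p) u.
Proof.
elim: p u => [|e p IHp] u; first by rewrite /= eq_sym.
case/andP=> /eqP <- /IHp walk_p; rewrite reverse_path_cons.
by apply: walk_cat walk_p _; rewrite /= orig_bar term_bar !eqxx.
Qed.

Lemma walk_path e p v : walk (orig e) (e :: p) v =
  path (fun e f => term e == orig f) e p && (term (last e p) == v).
Proof.
elim: p e => [|f p IHp] e; first by rewrite /= eqxx.
by rewrite [in RHS]/= -andbA -IHp /= !eqxx eq_sym.
Qed.

Lemma walk_closed u p : walk u p u -> closed_path p.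
Proof.
case: p => // e p wp; rewrite /closed_path /= rcons_path -walk_path.
by have /andP[/eqP-> _] := wp.
Qed.

Lemma closed_walk p : (0 < size p)%N -> closed_path p -> exists u, walk u p u.
Proof.
case: p => // e p _; rewrite /closed_path /= rcons_path -walk_path => wp.
by exists (orig e).
Qed.

Lemma orientationsP p q : reflect
  (exists2 k, (k < size p)%N & q = rot k p \/ q = reverse_path (rot k p))
  (q \in orientations p).
Proof.
rewrite /orientations in_fset mem_cat; apply: (iffP orP).
  case=> /mapP[r]; first by rewrite mem_iota => lt_k ->; exists r => //; left.
  by move/mapP=> [k]; rewrite mem_iota => lt_k -> ->; exists k => //; right.
case=> k lt_k [->|->]; [left|right].
  by apply/mapP; exists k; rewrite ?mem_iota.
by apply/map_f/mapP; exists k; rewrite ?mem_iota.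
Qed.

Lemma closed_path_orientation p q :
  closed_path p -> q \in orientations p -> closed_path q.
Proof.
move=> clp /orientationsP[k lt_k].
have clk : closed_path (rot k p) by rewrite /closed_path rot_cycle.
case=> -> //; have [|u wu] := closed_walk _ clk.
  by rewrite size_rot; apply: leq_trans lt_k.
exact: walk_closed (walk_reverse wu).
Qed.

Lemma size_orientation p q : q \in orientations p -> size q = size p.
Proof.
by case/orientationsP=> k _ [->|->]; rewrite ?size_rev ?size_map size_rot.
Qed.

Lemma all_orientation (T : {set (dedge G)}) p q :
    (forall e, e \in T -> bar e \in T) ->
  q \in orientations p -> all (mem T) p -> all (mem T) q.
Proof.
move=> Tbar /orientationsP[k _ eq_q] /allP pT.
have rT e : e \in rot k p -> e \in T by rewrite mem_rot; apply: pT.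
case: eq_q => ->; apply/allP => e; first exact: rT.
by rewrite mem_rev => /mapP[f /rT fT ->]; apply: Tbar.
Qed.

Lemma not_cyclically_reduced p : ~ cyclically_reduced p ->
  exists e a b, a ++ [:: e; bar e] ++ b \in orientations p.
Proof.
move=> not_red.
case: (boolP (all (fun q => [forall e, ~~ infix [:: e; bar e] q])
                  (enum_fset (orientations p)))) => [/allP red|].
  by case: not_red => q /red/forallP.
case/allPn=> q q_p /forallPn[e]; rewrite negbK => /infixP[a [b eq_q]].
by exists e, a, b; rewrite -eq_q.
Qed.

Lemma uedge_of_subproof e : [set e; bar e] \in uedges G.
Proof. exact: imset_f. Qed.

Definition uedge_of e : uedge G := Sub [set e; bar e] (uedge_of_subproof e).

Lemma uedge_of_eq e f : uedge_of e = uedge_of f -> f = e \/ f = bar e.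
Proof.
move/(congr1 val) => /= eq_ef; have : f \in [set e; bar e] by rewrite eq_ef set21.
by rewrite !inE => /orP[]/eqP; [left | right].
Qed.

Lemma uedge_of_bar e : uedge_of (bar e) = uedge_of e.
Proof. by apply: val_inj; rewrite /= barK setUC. Qed.

Lemma eq_uedge_of e f : (uedge_of f == uedge_of e) = (f == e) || (f == bar e).
Proof.
apply/eqP/orP => [/esym/uedge_of_eq[]->|]; first by left.
  by right.
by case=> /eqP->; rewrite ?uedge_of_bar.
Qed.

Lemma uedgeP (c : uedge G) : exists e, c = uedge_of e.
Proof.
case: c => c cP; have /imsetP[e _ eq_c] := cP.
by exists e; apply: val_inj.
Qed.

(** The two orientations of an edge are distinct, so every fibre of [uedge_of]
    has two elements; this is the factor 2 of the second comparison. *)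
Lemma card_dedge : #|dedge G| = (2 * #|uedge G|)%N.
Proof.
rewrite -sum1_card (partition_big uedge_of predT) //= mulnC -sum_nat_const.
apply: eq_bigr => c _; have [e ->] := uedgeP c.
have <- : #|[set e; bar e]| = 2%N by rewrite cards2 eq_sym bar_neq.
by rewrite -sum1_card; apply: eq_bigl => f; rewrite eq_uedge_of !inE.
Qed.

(** A walk with distinct vertices serves: a repeated unoriented edge would force
    a repeated vertex. *)
Lemma uniq_walk (T : {set (dedge G)}) u v : connect (joined_by T) u v ->
  exists p, [&& walk u p v, all (mem T) p & uniq (map uedge_of p)].
Proof.
case/connectP=> s0 /shortenP[s path_s uniq_s _ ->] {s0}.
suff [p [p1 p2 p3 _]] : exists p, [/\ walk u p (last u s), all (mem T) p,
    uniq (map uedge_of p)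
  & forall e, e \in p -> (orig e \in u :: s) && (term e \in u :: s)].
  by exists p; apply/and3P.
elim: s u path_s uniq_s => [|x s IHs] u /=; first by exists [::]; rewrite /= eqxx.
case/andP=> /existsP[e /and3P[eT /eqP <- /eqP <-]] path_s /andP[u_s uniq_s].
have [p [p1 p2 p3 p4]] := IHs _ path_s uniq_s.
exists (e :: p); split; rewrite /= ?eqxx ?eT //=.
  rewrite p3 andbT; apply/mapP=> -[f /p4/andP[f1 f2] /uedge_of_eq[ef|ef]].
    by rewrite ef (negbTE u_s) in f1.
  by rewrite ef term_bar (negbTE u_s) in f2.
move=> f; rewrite inE => /predU1P[->|/p4/andP[f1 f2]].
  by rewrite !inE !eqxx orbT.
by rewrite inE f1 inE f2 !orbT.
Qed.

End Walks.

Lemma exists_tree_walks (G : graph) (T : {set (dedge G)}) (o : vert G) :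
    spanning_tree T ->
  exists tp : vert G -> seq (dedge G), forall v,
  [&& walk o (tp v) v, all (mem T) (tp v) & uniq (map (@uedge_of G) (tp v))].
Proof.
case=> _ conT _.
exact: (fin_all_exists (fun v => uniq_walk (conT o v))).
Qed.

(** * Coboundaries and gauge transformations *)

Definition antisymmetric_cochain (G : graph) n (alpha : dedge G -> 'S_n) :=
  forall e, alpha (bar e) = (alpha e)^-1%g.

Definition gauge (G : graph) n (c : vert G -> 'S_n) (alpha : dedge G -> 'S_n) e :=
  (c (orig e) * alpha e * (c (term e))^-1)%g.

Section Coboundary.
Variables (X : polygonal_complex) (n : nat).
Implicit Types (alpha : dedge X -> 'S_n) (c : vert X -> 'S_n).
Implicit Types (p q : seq (dedge X)).

Lemma coboundary_cat alpha p q :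
  coboundary alpha (p ++ q) = (coboundary alpha p * coboundary alpha q)%g.
Proof. exact: big_cat. Qed.

Lemma coboundary_cons alpha e p :
  coboundary alpha (e :: p) = (alpha e * coboundary alpha p)%g.
Proof. exact: big_cons. Qed.

Lemma coboundary_nil alpha : coboundary alpha [::] = 1%g.
Proof. exact: big_nil. Qed.

Lemma coboundary_trivial alpha p :
  (forall e, e \in p -> alpha e = 1%g) -> coboundary alpha p = 1%g.
Proof. by move=> alpha1; rewrite /coboundary big_seq big1. Qed.

Lemma coboundary_reverse alpha p : antisymmetric_cochain alpha ->
  coboundary alpha (reverse_path p) = (coboundary alpha p)^-1%g.
Proof.
move=> alphaV; elim: p => [|e p IHp]; first by rewrite !coboundary_nil invg1.
rewrite reverse_path_cons coboundary_cat IHp !coboundary_cons coboundary_nil.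
by rewrite alphaV mulg1 invMg.
Qed.

(** A cyclic shift conjugates the coboundary and reversal inverts it. *)
Lemma coboundary_orientation alpha p q : antisymmetric_cochain alpha ->
  q \in orientations p -> exists x,
    coboundary alpha q = (coboundary alpha p ^ x)%g \/
    coboundary alpha q = ((coboundary alpha p)^-1 ^ x)%g.
Proof.
move=> alphaV /orientationsP[k _ eq_q]; exists (coboundary alpha (take k p)).
have rotE : coboundary alpha (rot k p)
    = (coboundary alpha p ^ coboundary alpha (take k p))%g.
  rewrite -[in X in (X ^ _)%g](cat_take_drop k p) !coboundary_cat.
  by rewrite conjgE mulgA mulKg.
case: eq_q => ->; [left | right]; rewrite ?coboundary_reverse // rotE //.
by rewrite conjVg.
Qed.

Lemma coboundary_orientation_eq1 alpha p q : antisymmetric_cochain alpha ->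
  q \in orientations p -> (coboundary alpha q == 1%g) = (coboundary alpha p == 1%g).
Proof.
move=> alphaV /(coboundary_orientation alphaV)[x].
by case=> ->; rewrite conjg_eq1 ?invg_eq1.
Qed.

Lemma gauge_antisymmetric c alpha :
  antisymmetric_cochain alpha -> antisymmetric_cochain (gauge c alpha).
Proof.
move=> alphaV e; rewrite /gauge alphaV term_bar orig_bar.
by rewrite !invMg invgK mulgA.
Qed.

(** The factors at the inner vertices cancel. *)
Lemma coboundary_gauge c alpha u p v : walk u p v ->
  coboundary (gauge c alpha) p = (c u * coboundary alpha p * (c v)^-1)%g.
Proof.
elim: p u => [|e p IHp] u /=.
  by move/eqP->; rewrite !coboundary_nil mulg1 mulgV.
case/andP=> /eqP <- /IHp eq_p.
by rewrite !coboundary_cons eq_p /gauge !mulgA mulgKV.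
Qed.

Lemma coboundary_gauge_eq1 c alpha p : closed_path p ->
  coboundary alpha p = 1%g -> coboundary (gauge c alpha) p = 1%g.
Proof.
case: (posnP (size p)) => [/size0nil-> *|p_gt0 /(closed_walk p_gt0)[u wp] alpha1].
  by rewrite coboundary_nil.
by rewrite (coboundary_gauge _ _ wp) alpha1 mulg1 mulgV.
Qed.

(** A nonempty closed path in the tree backtracks somewhere, and cancelling the
    backtrack leaves a shorter closed path with the same coboundary up to
    conjugation and inversion. *)
Lemma coboundary_closed_tree_path (T : {set (dedge X)}) alpha p :
    spanning_tree T -> antisymmetric_cochain alpha ->
  closed_path p -> all (mem T) p -> coboundary alpha p = 1%g.
Proof.
case=> Tbar _ Tacyclic alphaV; have [m] := ubnP (size p).
elim: m p => // m IHm p /ltnSE-le_pm clp pT.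
case: (posnP (size p)) => [/size0nil-> |p_gt0]; first exact: coboundary_nil.
have [|e [a [b q_p]]] := @not_cyclically_reduced _ p.
  by move=> red_p; have := Tacyclic _ p_gt0 clp red_p; rewrite pT.
apply/eqP; rewrite -(coboundary_orientation_eq1 alphaV q_p); apply/eqP.
have qT := all_orientation Tbar q_p pT.
have size_q := size_orientation q_p.
have clq := closed_path_orientation clp q_p.
have [|u /walk_catP[w wa /walk_catP[x]]] := closed_walk _ clq.
  by rewrite size_q.
case/and3P=> /eqP ew _ /eqP <-; rewrite term_bar ew => wb.
rewrite !coboundary_cat !coboundary_cons coboundary_nil alphaV mulg1 mulgV mul1g.
rewrite -coboundary_cat; apply: IHm.
- by apply: leq_trans le_pm; rewrite -size_q !size_cat /= ltn_add2l.
- exact: walk_closed (walk_cat wa wb).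
- by move: qT; rewrite !all_cat => /and3P[-> _ ->].
Qed.

(** The potential at a vertex is the coboundary along a tree walk from a base
    vertex; going around through a tree edge closes up inside the tree. *)
Lemma gauge_tree_trivial (T : {set (dedge X)}) alpha o tp e :
    spanning_tree T -> antisymmetric_cochain alpha ->
    (forall v, walk o (tp v) v) -> (forall v, all (mem T) (tp v)) ->
  e \in T -> gauge (fun v => coboundary alpha (tp v)) alpha e = 1%g.
Proof.
move=> hT alphaV walk_tp tpT eT; have [Tbar _ _] := hT.
rewrite /gauge -coboundary_reverse // -mulgA -coboundary_cons -coboundary_cat.
apply: (coboundary_closed_tree_path hT alphaV).
  apply: (walk_closed (u := o)); apply: walk_cat (walk_tp _) _.
  by rewrite /= eqxx walk_reverse.
rewrite all_cat tpT /= eT /=; apply/allP=> f; rewrite mem_rev => /mapP[g gp ->].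
by apply: Tbar; apply: (allP (tpT _)) gp.
Qed.

End Coboundary.

(** * Words read along paths *)

Section Words.
Variables (X : polygonal_complex) (T S : {set (dedge X)}).
Hypothesis Tbar : forall e, e \in T -> bar e \in T.
Hypothesis hS : edge_representatives T S.

(** The cochain that a map of the generators determines: since neither
    orientation of a tree edge has a letter, it is trivial on the tree. *)
Definition extend n (f : {s : dedge X | s \in S} -> 'S_n) (e : dedge X) : 'S_n :=
  if letter S e is Some l then (if l.2 then (f l.1)^-1 else f l.1)%g else 1%g.

Lemma bar_notin_tree e : e \notin T -> bar e \notin T.
Proof. by apply: contra => /Tbar; rewrite barK. Qed.

Variant letter_spec (e : dedge X) :
    option ({s : dedge X | s \in S} * bool) -> Prop :=
  | LetterTree of e \in T : letter_spec e None
  | LetterPos s of val s = e & e \notin T : letter_spec e (Some (s, false))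
  | LetterNeg s of val s = bar e & e \notin T : letter_spec e (Some (s, true)).

Lemma letterP e : letter_spec e (letter S e).
Proof.
have [ST Srep] := hS; rewrite /letter.
case: insubP => [s eS es|enS]; first exact: LetterPos es (ST _ eS).
case: insubP => [s beS eqs|benS].
  by apply: LetterNeg eqs _; rewrite -(barK e) bar_notin_tree ?ST.
apply: LetterTree; apply: contraT => /Srep.
by rewrite (negbTE enS) (negbTE benS).
Qed.

Lemma letter_bar e : letter S (bar e) = omap (fun l => (l.1, ~~ l.2)) (letter S e).
Proof.
have [ST Srep] := hS.
case: (letterP e) => [eT|s es eT|s es eT] /=; case: (letterP (bar e)).
- by [].
- by move=> ? _; rewrite Tbar.
- by move=> ? _; rewrite Tbar.
- by rewrite (negbTE (bar_notin_tree eT)).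
- move=> t et _; have := Srep _ eT.
  by rewrite -{1}es -et !(valP s) !(valP t).
- by move=> t; rewrite barK -es => /val_inj-> _.
- by rewrite (negbTE (bar_notin_tree eT)).
- by move=> t; rewrite -es => /val_inj-> _.
- move=> t; rewrite barK => et _; have := Srep _ eT.
  by rewrite -es -et !(valP s) !(valP t).
Qed.

Lemma extend_antisymmetric n (f : {s | s \in S} -> 'S_n) :
  antisymmetric_cochain (extend f).
Proof.
move=> e; rewrite /extend letter_bar.
by case: (letter S e) => [[s []]|] /=; rewrite ?invgK ?invg1.
Qed.

Lemma extend_tree n (f : {s | s \in S} -> 'S_n) e : e \in T -> extend f e = 1%g.
Proof. by rewrite /extend; case: letterP => // s _ /negbTE->. Qed.

Lemma extend_val n (f : {s | s \in S} -> 'S_n) s : extend f (val s) = f s.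
Proof. by rewrite /extend /letter valK. Qed.

(** Deleting the tree letters from a path does not change the product of a
    cochain that is trivial on the tree. *)
Lemma eval_word_of_path n (omega : dedge X -> 'S_n) p :
    antisymmetric_cochain omega -> (forall e, e \in T -> omega e = 1%g) ->
  eval_word (fun s : {s | s \in S} => omega (val s)) (word_of_path T S p)
    = coboundary omega p.
Proof.
move=> omegaV omega1; elim: p => [|e p IHp].
  by rewrite coboundary_nil /eval_word big_nil.
rewrite coboundary_cons -IHp /word_of_path /=.
case: ifPn => [eT|/negbNE eT]; last by rewrite omega1 ?mul1g.
rewrite /= {1}/oapp; case: letterP => [|s <- _|s es _].
- by rewrite (negbTE eT).
- by rewrite /eval_word big_cons.
- by rewrite /eval_word big_cons /= es omegaV invgK.
Qed.

Lemma eval_word_extend n (f : {s | s \in S} -> 'S_n) p :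
  eval_word f (word_of_path T S p) = coboundary (extend f) p.
Proof.
rewrite -eval_word_of_path; [|exact: extend_antisymmetric|exact: extend_tree].
by apply: eq_bigr => l _; rewrite extend_val.
Qed.

Lemma uedge_of_gens_inj :
  injective (fun s : {s | s \in S} => uedge_of (val s)).
Proof.
have [ST Srep] := hS.
move=> s t /uedge_of_eq[/val_inj-> //|ets].
have := Srep _ (ST _ (valP s)).
by rewrite (valP s) -ets (valP t).
Qed.

(** Outside the tree, one of the two orientations of an edge is a generator. *)
Lemma notin_codom_gens_tree e :
  uedge_of e \notin codom (fun s : {s | s \in S} => uedge_of (val s)) -> e \in T.
Proof.
have [_ Srep] := hS; apply: contraR => /Srep.
case: (boolP (e \in S)) => [eS _|_ /= beS]; apply/codomP.
  by exists (Sub e eS).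
by exists (Sub (bar e) beS); rewrite uedge_of_bar.
Qed.

End Words.

(** * Averages and infima *)

Section Averages.
Variables (R : realType).

Lemma average_ge0 (I : finType) (F : I -> R) :
  (forall i, 0 <= F i) -> 0 <= average F.
Proof. by move=> F0; rewrite /average divr_ge0 ?ler0n ?sumr_ge0. Qed.

Lemma ler_average (I : finType) (F G : I -> R) :
  (forall i, F i <= G i) -> average F <= average G.
Proof. by move=> FG; rewrite /average ler_wpM2r ?invr_ge0 ?ler0n ?ler_sum. Qed.

Lemma average_le (I : finType) (F : I -> R) b :
  0 <= b -> (forall i, F i <= b) -> average F <= b.
Proof.
move=> b0 Fb; rewrite /average; case: (posnP #|I|) => [->|I0].
  by rewrite invr0 mulr0.
rewrite ler_pdivrMr ?ltr0n // mulr_natr -sumr_const.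
exact: ler_sum.
Qed.

Lemma average_const (I : finType) (b : R) : (0 < #|I|)%N ->
  average (fun _ : I => b) = b.
Proof.
move=> I0; rewrite /average sumr_const -(mulr_natr b); apply: mulfK.
by rewrite pnatr_eq0 -lt0n.
Qed.

(** This compares unoriented edges with generators: tree edges take the minimal
    value [m].  After subtracting [m] both averages have the same numerator, which
    is nonnegative, and the left one has the larger denominator. *)
Lemma average_extend_min (I J : finType) (h : J -> I) (g : I -> R) m :
    injective h -> (0 < #|J|)%N -> (forall j, m <= g (h j)) ->
    (forall i, i \notin codom h -> g i = m) ->
  average g <= average (g \o h).
Proof.
move=> inj_h J0 le_m eq_m; have le_JI := leq_card h inj_h.
have I0 : (0 < #|I|)%N := leq_trans J0 le_JI.
have sub_m (K : finType) (F : K -> R) : (0 < #|K|)%N ->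
    average F = average (fun k => F k - m) + m.
  move=> K0; rewrite -[X in _ = _ + X](average_const m K0) /average -mulrDl.
  by rewrite -big_split; congr (_ / _); apply: eq_bigr => k _; rewrite /= subrK.
rewrite (sub_m _ g) // (sub_m _ (g \o h)) // lerD2r /average.
have -> : \sum_i (g i - m) = \sum_j ((g \o h) j - m).
  rewrite (bigID (mem (codom h))) /= [X in _ + X]big1 ?addr0; last first.
    by move=> i /eq_m ->; rewrite subrr.
  rewrite -(@big_image _ _ _ _ _ h predT (fun i => g i - m)).
  by rewrite big_uniq // map_inj_uniq ?enum_uniq.
rewrite ler_wpM2l //; first by apply: sumr_ge0 => j _; rewrite subr_ge0 /=.
by rewrite lef_pV2 ?posrE ?ltr0n // ler_nat.
Qed.

Lemma inf_le_scale (A B : set R) (k : R) : 0 <= k ->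
    (forall x, A x -> 0 <= x) -> (exists y, B y) ->
    (forall y, B y -> exists2 x, A x & x <= k * y) ->
  inf A <= k * inf B.
Proof.
move=> k_ge0 A_ge0 [y0 By0] AB.
have infA_le x : A x -> inf A <= x.
  by apply: ge_inf; exists 0 => z /A_ge0.
have le_kB y : B y -> inf A <= k * y.
  by case/AB=> x /infA_le le_x /(le_trans le_x).
case: (eqVneq k 0) => [k0|k_neq0].
  by have := le_kB _ By0; rewrite k0 !mul0r.
have k_gt0 : 0 < k by rewrite lt_def k_neq0.
rewrite -ler_pdivrMl //; apply: lb_le_inf; first by exists y0.
by move=> y /le_kB; rewrite ler_pdivrMl.
Qed.

End Averages.

(** * Distances of cochains *)

Section CochainDistance.
Variables (R : realType) (X : polygonal_complex).

Lemma d_h_orientation n (alpha : dedge X -> 'S_n) p q : (0 < n)%N ->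
    antisymmetric_cochain alpha -> q \in orientations p ->
  d_h R (coboundary alpha q) (1%g : 'S_n) = d_h R (coboundary alpha p) (1%g : 'S_n).
Proof.
move=> n0 alphaV q_p.
have conj1 (s x : 'S_n) : d_h R (s ^ x)%g (1%g : 'S_n) = d_h R s (1%g : 'S_n).
  rewrite -(d_h_translate R (leqnn n) n0 x^-1%g s x) !widen_perm_id.
  by rewrite mulg1 mulVg conjgE mulgA.
case: (coboundary_orientation alphaV q_p) => x [->|->]; rewrite conj1 //.
by rewrite -{1}invg1 d_hV.
Qed.

Section Nested.
Variables (n N : nat) (le_nN : (n <= N)%N) (N_gt0 : (0 < N)%N).
Variables (alpha : dedge X -> 'S_n) (beta : dedge X -> 'S_N).
Hypotheses (alphaV : antisymmetric_cochain alpha).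
Hypotheses (betaV : antisymmetric_cochain beta).

Definition uedge_dist (c : uedge X) : R :=
  if [pick e in val c] is Some e then d_h R (alpha e) (beta e) else 0.

Lemma uedge_dist_ge0 c : 0 <= uedge_dist c.
Proof. by rewrite /uedge_dist; case: pickP => // e _; apply: d_h_ge0. Qed.

Lemma uedge_distE e : uedge_dist (uedge_of e) = d_h R (alpha e) (beta e).
Proof.
rewrite /uedge_dist; case: pickP => [f|/(_ e)]; last by rewrite /= set21.
by rewrite /= !inE => /orP[]/eqP-> //; rewrite alphaV betaV d_hV.
Qed.

(** The path must be nonempty: when [n < N] even two identity permutations are at
    positive distance. *)
Lemma d_h_coboundary p : (0 < size p)%N ->
  d_h R (coboundary alpha p) (coboundary beta p)
    <= \sum_(e <- p) uedge_dist (uedge_of e).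
Proof.
case: p => // e p _; elim: p e => [|f p IHp] e.
  by rewrite big_seq1 !coboundary_cons !coboundary_nil !mulg1 uedge_distE.
rewrite big_cons !(coboundary_cons _ e) uedge_distE.
apply: le_trans (d_hM _ _ _ _ _ _ _) _ => //.
by rewrite lerD2l.
Qed.

Lemma sum_uedge_dist_uniq p : uniq (map (@uedge_of X) p) ->
  \sum_(e <- p) uedge_dist (uedge_of e) <= \sum_c uedge_dist c.
Proof.
move=> uniq_p; rewrite -(big_map (@uedge_of X) predT uedge_dist).
rewrite big_uniq // [leRHS](bigID (mem (map (@uedge_of X) p))) /= lerDl.
by apply: sumr_ge0 => c _; apply: uedge_dist_ge0.
Qed.

End Nested.
End CochainDistance.

Section PolygonRepresentatives.
Variables (R : realType) (X : polygonal_complex).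
Variable rep : upolygon X -> seq (dedge X).
Hypothesis hrep : forall c : upolygon X, rep c \in val c.

Lemma upolygonP (c : upolygon X) :
  exists2 p, p \in opoly X & val c = orientations p.
Proof. by have /imfsetP[p p_X eq_c] := valP c; exists p. Qed.

Lemma rep_closed c : closed_path (rep c).
Proof.
have [p p_X eq_c] := upolygonP c; have := hrep c; rewrite eq_c.
by move/(fsubsetP (opoly_orientations p_X))/opolyP=> [].
Qed.

Lemma coboundary_rep_opoly n (psi : dedge X -> 'S_n) :
    antisymmetric_cochain psi -> (forall c, coboundary psi (rep c) = 1%g) ->
  forall p, p \in opoly X -> coboundary psi p = 1%g.
Proof.
move=> psiV psi1 p p_X.
have p_c : orientations p \in upolygons X by apply/imfsetP; exists p.
have := hrep [` p_c]%fset; rewrite /= => /(coboundary_orientation_eq1 psiV).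
by rewrite psi1 eqxx => /esym/eqP.
Qed.

Lemma cocycle_rep n (psi : dedge X -> 'S_n) c :
  cocycle psi -> coboundary psi (rep c) = 1%g.
Proof.
move=> [_]; apply; have [p p_X eq_c] := upolygonP c; have := hrep c; rewrite eq_c.
by move/(fsubsetP (opoly_orientations p_X)).
Qed.

(** The representatives chosen for the presentation and those used in
    [def_cocyc] are orientations of the same polygons. *)
Lemma def_cocyc_rep n (alpha : dedge X -> 'S_n) : (0 < n)%N ->
    antisymmetric_cochain alpha ->
  def_cocyc R alpha = average (fun c : upolygon X =>
    d_h R (coboundary alpha (rep c)) (1%g : 'S_n)).
Proof.
move=> n0 alphaV; congr (_ / _); apply: eq_bigr => c _.
have [p p_X eq_c] := upolygonP c.
have repr_c : polygon_repr c \in enum_fset (val c).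
  rewrite /polygon_repr; have : rep c \in enum_fset (val c) by apply: hrep.
  by case: (enum_fset _) => // q l _; apply: mem_head.
have := hrep c; rewrite eq_c => rep_p.
have repr_p : polygon_repr c \in orientations p by rewrite -eq_c.
by rewrite (d_h_orientation R n0 alphaV rep_p) (d_h_orientation R n0 alphaV repr_p).
Qed.

End PolygonRepresentatives.

(** * Comparing homomorphisms and cocycles *)

Section Comparison.
Variables (R : realType) (X : polygonal_complex) (T S : {set (dedge X)}).
Variable rep : upolygon X -> seq (dedge X).
Hypotheses (hT : spanning_tree T) (hS : edge_representatives T S).
Hypothesis hrep : forall c : upolygon X, rep c \in val c.
Variables (o : vert X) (tp : vert X -> seq (dedge X)).
Hypothesis walk_tp : forall v, walk o (tp v) v.
Hypothesis tpT : forall v, all (mem T) (tp v).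
Hypothesis uniq_tp : forall v, uniq (map (@uedge_of X) (tp v)).

Let Tbar : forall e, e \in T -> bar e \in T. Proof. by case: hT. Qed.

Definition tree_gauge n (alpha : dedge X -> 'S_n) : dedge X -> 'S_n :=
  gauge (fun v => coboundary alpha (tp v)) alpha.

Lemma tree_gauge_antisymmetric n (alpha : dedge X -> 'S_n) :
  antisymmetric_cochain alpha -> antisymmetric_cochain (tree_gauge alpha).
Proof. exact: gauge_antisymmetric. Qed.

Lemma tree_gauge_tree n (alpha : dedge X -> 'S_n) e :
  antisymmetric_cochain alpha -> e \in T -> tree_gauge alpha e = 1%g.
Proof. by move=> alphaV; apply: gauge_tree_trivial. Qed.

Lemma eval_word_tree_gauge n (alpha : dedge X -> 'S_n) p :
    antisymmetric_cochain alpha ->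
  eval_word (fun s : {s | s \in S} => tree_gauge alpha (val s)) (word_of_path T S p)
    = coboundary (tree_gauge alpha) p.
Proof.
move=> alphaV; apply: eval_word_of_path => // [|e eT].
  exact: tree_gauge_antisymmetric.
exact: tree_gauge_tree.
Qed.

(** The gauge conjugates the coboundaries of polygons, which does not affect their
    distance to the identity. *)
Lemma def_hom_tree_gauge n (alpha : dedge X -> 'S_n) : (0 < n)%N ->
    antisymmetric_cochain alpha ->
  @def_hom R (tree_presentation T S rep) n (fun s => tree_gauge alpha (val s))
    = def_cocyc R alpha.
Proof.
move=> n0 alphaV; rewrite (def_cocyc_rep R hrep n0 alphaV).
congr (_ / _); apply: eq_bigr => c _; rewrite /= eval_word_tree_gauge //.
case: (posnP (size (rep c))) => [/size0nil->|p_gt0]; first by rewrite !coboundary_nil.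
have [u wu] := closed_walk p_gt0 (rep_closed hrep c).
rewrite /tree_gauge (coboundary_gauge _ _ wu).
set x := coboundary alpha (tp u).
rewrite -[RHS](d_h_translate R (leqnn n) n0 x _ x^-1%g) !widen_perm_id.
by rewrite mulg1 mulgV.
Qed.

Lemma def_hom_extend n (f : {s | s \in S} -> 'S_n) : (0 < n)%N ->
  @def_hom R (tree_presentation T S rep) n f = def_cocyc R (extend f).
Proof.
move=> n0; rewrite (def_cocyc_rep R hrep n0 (extend_antisymmetric Tbar hS f)).
by congr (_ / _); apply: eq_bigr => c _; rewrite /= eval_word_extend.
Qed.

Lemma coboundary_widen n N (le_nN : (n <= N)%N) (alpha : dedge X -> 'S_n) p :
  coboundary (widen_perm le_nN \o alpha) p = widen_perm le_nN (coboundary alpha p).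
Proof.
by rewrite /coboundary (big_morph _ (widen_permM le_nN) (widen_perm1 le_nN)).
Qed.

Lemma widen_antisymmetric n N (le_nN : (n <= N)%N) (alpha : dedge X -> 'S_n) :
  antisymmetric_cochain alpha -> antisymmetric_cochain (widen_perm le_nN \o alpha).
Proof. by move=> alphaV e; rewrite /= alphaV widen_permV. Qed.

Section FromHomomorphism.
Variables (n : nat) (alpha : dedge X -> 'S_n).
Hypotheses (n_ge2 : (2 <= n)%N) (alphaV : antisymmetric_cochain alpha).

(** The inverse gauge of [alpha], widened to [M] points, turns the homomorphism
    into a cocycle whose distances to [alpha] are those before the gauge. *)
Lemma cocycle_of_hom_widened M (le_nM : (n <= M)%N) N (le_NM : (N <= M)%N)
    (phi : {s | s \in S} -> 'S_N) :
    (forall c, eval_word phi (word_of_path T S (rep c)) = 1%g) ->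
  exists2 psi : dedge X -> 'S_M, cocycle psi &
    forall e, d_h R (alpha e) (psi e)
      = d_h R (tree_gauge alpha e) (widen_perm le_NM (extend phi e)).
Proof.
move=> phi1; pose w := widen_perm le_NM \o extend phi.
have wV : antisymmetric_cochain w.
  exact: widen_antisymmetric (extend_antisymmetric Tbar hS phi).
have w1 c : coboundary w (rep c) = 1%g.
  by rewrite coboundary_widen -(eval_word_extend Tbar hS) phi1 widen_perm1.
have M_gt0 : (0 < M)%N by apply: leq_trans le_nM; apply: ltnW.
pose b v := (coboundary alpha (tp v))^-1%g.
exists (gauge (fun v => widen_perm le_nM (b v)) w).
  split; first split; first exact: leq_trans le_nM.
    exact: gauge_antisymmetric.
  apply: (coboundary_rep_opoly hrep); first exact: gauge_antisymmetric.
  by move=> c; apply: coboundary_gauge_eq1; rewrite ?w1 ?(rep_closed hrep).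
move=> e; rewrite -[RHS](d_h_translate R le_nM M_gt0 (b (orig e)) _ (b (term e))^-1%g).
rewrite /gauge widen_permV; congr (d_h R _ _).
by rewrite /tree_gauge /gauge /b invgK !mulgA mulVg mul1g mulgKV.
Qed.

(** Edge by edge the un-gauged cocycle is no farther than the homomorphism, but it
    also has to be compared on tree edges.  There both gauged cochains are
    trivial, at the least distance that two permutations of [n] and [M] points
    can have, so including the tree edges does not increase the average. *)
Lemma exists_cocycle_near N (phi : {s | s \in S} -> 'S_N) :
    (forall c, eval_word phi (word_of_path T S (rep c)) = 1%g) ->
  exists M (psi : dedge X -> 'S_M), cocycle psi /\
    d_cochain R alpha psi
      <= d_gens R (fun s : {s | s \in S} => tree_gauge alpha (val s)) phi.
Proof.
move=> phi1; case: (posnP #|{: {s | s \in S}}|) => [S0|S_gt0].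
  (* With no generators the cochain is gauge equivalent to the trivial one, so
     no enlargement of the permuted set is needed. *)
  pose phi0 := fun s : {s | s \in S} => 1%g : 'S_n.
  have [|psi psi_coc dist_psi] := @cocycle_of_hom_widened n (leqnn n) n (leqnn n) phi0.
    move=> c; rewrite /eval_word big1 // => l _.
    by rewrite /phi0 invg1 if_same.
  exists n, psi; split=> //; rewrite /d_gens /average S0 invr0 mulr0.
  apply: average_le => // c; have [e ->] := uedgeP c.
  have eT : e \in T.
    apply: (notin_codom_gens_tree hS); apply/codomP=> -[s _].
    by have := card0_eq S0 s; rewrite inE.
  have psiV : antisymmetric_cochain psi by case: psi_coc => -[].
  have n_gt0 : (0 < n)%N := ltnW n_ge2.
  have := uedge_distE R (leqnn n) n_gt0 alphaV psiV e; rewrite /uedge_dist => ->.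
  rewrite dist_psi tree_gauge_tree // (extend_tree Tbar hS) // widen_perm1.
  by rewrite d_h11 // divff ?subrr // pnatr_eq0 -lt0n.
pose M := maxn n N.
have le_nM : (n <= M)%N := leq_maxl n N.
have M_gt0 : (0 < M)%N by apply: leq_trans le_nM; apply: ltnW.
have [psi psi_coc dist_psi] := cocycle_of_hom_widened le_nM (leq_maxr n N) phi1.
exists M, psi; split=> //.
have psiV : antisymmetric_cochain psi by case: psi_coc => -[].
have distE e : uedge_dist R alpha psi (uedge_of e) =
    d_h R (tree_gauge alpha e) (widen_perm (leq_maxr n N) (extend phi e)).
  by rewrite (uedge_distE R le_nM M_gt0 alphaV psiV) dist_psi.
apply: le_trans (average_extend_min (g := uedge_dist R alpha psi)
  (m := 1 - n%:R / M%:R) (uedge_of_gens_inj hS) S_gt0 _ _) _.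
- by move=> s; rewrite distE; apply: d_h_ge.
- move=> c; have [e ->] := uedgeP c => /(notin_codom_gens_tree hS) eT.
  by rewrite distE tree_gauge_tree // (extend_tree Tbar hS) // widen_perm1 d_h11.
apply: ler_average => s; rewrite /= distE extend_val.
exact: d_h_widen_le.
Qed.

End FromHomomorphism.

(** Gauging the cocycle gives a homomorphism.  Its value at a generator [e] is the
    coboundary along the loop that follows the tree to [e], crosses [e] and
    returns through the tree.  The extension of [f] has coboundary [f e] along
    that loop, and the loop passes at most twice through every unoriented edge,
    so by subadditivity the distance at [e] is at most twice the sum over the
    unoriented edges. *)
Lemma exists_hom_near n (f : {s | s \in S} -> 'S_n) N (psi : dedge X -> 'S_N) :
    (0 < n)%N -> cocycle psi ->
  exists M (phi : {s | s \in S} -> 'S_M),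
    [/\ (0 < M)%N, forall c, eval_word phi (word_of_path T S (rep c)) = 1%g &
      d_gens R f phi <= #|dedge X|%:R * d_cochain R (extend f) psi].
Proof.
move=> n_gt0 psi_coc; have [[_ psiV] _] := psi_coc.
pose M := maxn n N; have le_nM : (n <= M)%N := leq_maxl n N.
have M_gt0 : (0 < M)%N := leq_trans n_gt0 le_nM.
pose w := widen_perm (leq_maxr n N) \o psi.
have wV : antisymmetric_cochain w by apply: widen_antisymmetric.
have fV := extend_antisymmetric Tbar hS f.
pose D := \sum_c uedge_dist R (extend f) w c.
have D_ge0 : 0 <= D by apply: sumr_ge0 => c _; apply: uedge_dist_ge0.
exists M, (fun s => tree_gauge w (val s)); split=> // [c|].
  rewrite eval_word_tree_gauge // coboundary_gauge_eq1 ?(rep_closed hrep) //.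
  by rewrite coboundary_widen (cocycle_rep hrep) ?widen_perm1.
have le_D : 2%:R * D <= #|dedge X|%:R * d_cochain R (extend f) psi.
  case: (posnP #|uedge X|) => [E0|E_gt0].
    have -> : D = 0 by apply: big1 => c; have := card0_eq E0 c; rewrite inE.
    by rewrite mulr0 mulr_ge0 ?ler0n // average_ge0 // => c; apply: uedge_dist_ge0.
  rewrite card_dedge natrM -mulrA ler_wpM2l ?ler0n //.
  rewrite /d_cochain /average mulrC divfK ?pnatr_eq0 -?lt0n //.
  apply: ler_sum => c _; have [e ->] := uedgeP c.
  rewrite /uedge_dist; case: pickP => // g _; exact: d_h_widen_le.
apply: le_trans le_D; apply: average_le => [|s]; first by rewrite mulr_ge0 ?ler0n.
pose e := val s; pose p := tp (orig e) ++ e :: reverse_path (tp (term e)).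
have fp : f s = coboundary (extend f) p.
  have f1 v : coboundary (extend f) (tp v) = 1%g.
    apply: coboundary_trivial => g g_tp; apply: (extend_tree Tbar hS).
    exact: (allP (tpT v)).
  rewrite coboundary_cat coboundary_cons coboundary_reverse // !f1.
  by rewrite invg1 mulg1 mul1g extend_val.
have -> : tree_gauge w e = coboundary w p.
  by rewrite coboundary_cat coboundary_cons coboundary_reverse // mulgA.
rewrite fp; apply: le_trans (d_h_coboundary _ le_nM M_gt0 fV wV _) _.
  by rewrite size_cat addnS.
have -> : \sum_(g <- p) uedge_dist R (extend f) w (uedge_of g)
    = \sum_(g <- e :: tp (orig e)) uedge_dist R (extend f) w (uedge_of g)
      + \sum_(g <- tp (term e)) uedge_dist R (extend f) w (uedge_of g).
  rewrite big_cat !big_cons /= addrCA addrA; congr (_ + _).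
  rewrite /reverse_path (perm_big _ (permEl (perm_rev _))) big_map.
  by apply: eq_bigr => g _; rewrite uedge_of_bar.
rewrite mulr2n mulrDl mul1r.
rewrite lerD //; apply: sum_uedge_dist_uniq; rewrite ?uniq_tp //=.
rewrite uniq_tp andbT; apply/mapP => -[g /(allP (tpT _)) /= gT /uedge_of_eq eg].
have [ST _] := hS; have := ST _ (valP s); rewrite -/e.
by case: eg => eg; rewrite ?eg in gT; rewrite ?gT // -(barK e) Tbar.
Qed.

End Comparison.

Theorem theorem1p3 (R : realType) (X : polygonal_complex)
    (hconn : connected_graph X) (basepoint : vert X)
    (T : {set (dedge X)}) (hT : spanning_tree T)
    (S : {set (dedge X)}) (hS : edge_representatives T S)
    (rep : upolygon X -> seq (dedge X))
    (hrep : forall c : upolygon X, rep c \in val c)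
    (rho : R -> R) (hrho : rate_function rho) :
  (hom_stable rho (tree_presentation T S rep) -> cocycle_stable rho X) /\
  (cocycle_stable rho X ->
   hom_stable (fun x => #|dedge X|%:R * rho x) (tree_presentation T S rep)).
Proof.
have [Tbar _ _] := hT.
have [tp tpP] := exists_tree_walks basepoint hT.
have walk_tp v : walk basepoint (tp v) v by case/and3P: (tpP v).
have tpT v : all (mem T) (tp v) by case/and3P: (tpP v).
have uniq_tp v : uniq (map (@uedge_of X) (tp v)) by case/and3P: (tpP v).
have d_cochain_ge0 n N (alpha : dedge X -> 'S_n) (beta : dedge X -> 'S_N) :
    0 <= d_cochain R alpha beta.
  by apply: average_ge0 => c; apply: uedge_dist_ge0.
have d_gens_ge0 n N (f : {s | s \in S} -> 'S_n) (g : {s | s \in S} -> 'S_N) :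
    0 <= d_gens R f g.
  by apply: average_ge0 => s; apply: d_h_ge0.
have rel1 n c :
    eval_word (fun s : {s | s \in S} => 1%g : 'S_n) (word_of_path T S (rep c)) = 1%g.
  by rewrite /eval_word big1 // => l _; rewrite invg1 if_same.
split=> stable n.
  move=> alpha [n_ge2 alphaV]; have n_gt0 := ltnW n_ge2.
  rewrite -(def_hom_tree_gauge R hT hS hrep walk_tp tpT n_gt0 alphaV).
  apply: le_trans (stable n (fun s => tree_gauge tp alpha (val s)) n_gt0).
  rewrite -[leRHS]mul1r; apply: inf_le_scale => //.
  - by move=> x [N [phi [_ ->]]].
  - exists (d_gens R (fun s : {s | s \in S} => tree_gauge tp alpha (val s))
              (fun=> 1%g : 'S_1)), 1%N, (fun=> 1%g).
    by split=> // c; apply: rel1.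
  move=> _ [N [phi [_ phi1 ->]]].
  have [M [psi [psi_coc le_psi]]] :=
    exists_cocycle_near R hT hS hrep walk_tp tpT n_ge2 alphaV phi1.
  by exists (d_cochain R alpha psi); [exists M, psi | rewrite mul1r].
move=> f n_gt0; case: (ltnP 1 n) => [n_ge2|n_le1]; last first.
  (* Cochains take values in permutations of at least two points, so cocycle
     stability says nothing here; but a map into the trivial group is already a
     homomorphism. *)
  have f1 s : f s = 1%g.
    apply/permP=> i; apply: val_inj.
    move: (f s i) ((1%g : 'S_n) i) => [j lt_j] [k lt_k] /=.
    by case: n n_le1 lt_j lt_k {f n_gt0 i} => [|[|]] // _; case: j => //; case: k.
  have [rho_ge0 _ _] := hrho.
  apply: (@le_trans _ _ 0); last first.
    by rewrite mulr_ge0 ?ler0n ?rho_ge0 // average_ge0 // => c; apply: d_h_ge0.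
  apply: ge_inf; first by exists 0 => x [N [phi [_ _ ->]]]; apply: d_gens_ge0.
  exists n, f; split=> // [c|].
    by rewrite /eval_word big1 // => l _; rewrite f1 invg1 if_same.
  rewrite /d_gens /average big1 ?mul0r // => s _.
  by rewrite f1 d_h11 // divff ?subrr // pnatr_eq0 -lt0n.
have fV := extend_antisymmetric Tbar hS f.
rewrite (def_hom_extend R hT hS hrep f n_gt0).
apply: le_trans (ler_wpM2l (ler0n _ _) (stable n (extend f) (conj n_ge2 fV))).
apply: inf_le_scale => //.
- by move=> x [N [phi [_ _ ->]]].
- exists (d_cochain R (extend f) (fun=> 1%g : 'S_2)), 2%N, (fun=> 1%g).
  split=> //; split; first by split=> // e; rewrite invg1.
  by move=> p _; apply: coboundary_trivial.
move=> _ [N [psi [psi_coc ->]]].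
have [M [phi [M_gt0 phi1 le_phi]]] :=
  exists_hom_near R hT hS hrep walk_tp tpT uniq_tp f n_gt0 psi_coc.
by exists (d_gens R f phi) => //; exists M, phi.
Qed.
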